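(* Let $T$ be a nonempty compact Hausdorff space, let $A \colon C(T) \to C(T)$ be a nonzero positive linear operator that is irreducible and eventually compact, let $b \in C(T)$ with $b \gg 0$, and let $s \in \mathbb{R}$ with $s \neq 0$. Then each of the two equations $$x = (A x^s)^{1/s} + b \qquad \text{and} \qquad y = \left( (Ay)^{1/s} + b \right)^s$$ has a unique strictly positive solution (that is, a unique solution $x \gg 0$, respectively $y \gg 0$) if and only if $r(A)^s < 1$.
   Context: $C(T)$ is the Banach lattice of continuous real-valued functions on the compact Hausdorff space $T$, with the supremum norm and the pointwise partial order $\leq$. $P = \{x \in C(T) : x \geq 0\}$ is its positive cone and $\mathring{P}$ is the (norm) interior of $P$. For $x,y \in C(T)$, $x \ll y$ (equivalently $y \gg x$) means $y - x \in \mathring{P}$; in particular $x \gg 0$ (''$x$ is strictly positive'') means $x \in \mathring{P}$. Powers are taken pointwise: $x^s$ is the function $t \mapsto x(t)^s$. A linear operator $A \colon C(T) \to C(T)$ is positive if it maps $P$ into $P$. It is eventually compact if there is $k \in \mathbb{N}$ such that $A^k$ is compact (maps the unit ball to a relatively compact set). An ideal in $C(T)$ is a vector subspace $I \subset C(T)$ such that $g \in I$, $f \in C(T)$ and $|f| \leq |g|$ imply $f \in I$. A positive linear operator $A$ is irreducible if the only nontrivial (i.e. nonzero) closed ideal invariant under $A$ is the whole space $C(T)$. The spectral radius is $r(A) = \lim_{k\to\infty} \|A^k\|^{1/k}$, with $\|\cdot\|$ the operator norm. *)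

(* Defs.v *)
From HB Require Import structures.
From mathcomp Require Import all_boot all_order all_algebra.
From mathcomp Require Import all_classical all_reals all_analysis.

Set Implicit Arguments.
Unset Strict Implicit.
Unset Printing Implicit Defensive.

Import Order.TTheory GRing.Theory Num.Theory.
Import numFieldNormedType.Exports.

Local Open Scope classical_set_scope.
Local Open Scope ring_scope.

Definition contfun_pred (R : realType) (T : topologicalType) :
    {pred T -> R} :=
  fun h : T -> R => `[< continuous h >].

Lemma contfun_predP (R : realType) (T : topologicalType) (h : T -> R) :
  reflect (continuous h) (h \in @contfun_pred R T).
Proof. exact: asboolP. Qed.

(* The compactness proof is a parameter of the type because the sup norm is a
   norm only on a compact space. *)
Record contfun (R : realType) (T : topologicalType) (cT : compact [set: T]) :=
  ContFun {
    contfun_val :> T -> R ;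
    contfun_contP : contfun_val \in @contfun_pred R T
  }.

Section contfun_theory.
Context (R : realType) (T : topologicalType) (cT : compact [set: T]).
Local Notation C := (contfun R cT).
Implicit Types f g : C.

HB.instance Definition _ := [isSub for @contfun_val R T cT].
HB.instance Definition _ := [Choice of C by <:].

Lemma contfun_continuous f : continuous f.
Proof. exact: (contfun_predP _ (contfun_contP f)). Qed.

Lemma contfun_submod_closed : submod_closed (@contfun_pred R T).
Proof.
split=> [|a u v].
  by apply: (introT (contfun_predP _)) => x; exact: cvg_cst.
move=> /contfun_predP cu /contfun_predP cv.
apply: (introT (contfun_predP _)) => x.
exact: (cvgD (cvgM (cvg_cst a) (cu x)) (cv x)).
Qed.

HB.instance Definition _ :=
  GRing.isSubmodClosed.Build R (T -> R) (@contfun_pred R T) contfun_submod_closed.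
HB.instance Definition _ := [SubChoice_isSubLmodule of C by <:].

Definition sup_norm f : R := sup [set `|f t| | t in [set: T]].

Lemma sup_norm_ub f t : `|f t| <= sup_norm f.
Proof.
apply: ub_le_sup; last by exists t.
have : compact (f @` [set: T]).
  apply: continuous_compact => //.
  by apply: continuous_subspaceT; exact: contfun_continuous.
move=> /compact_bounded [M [_ HM]].
by exists (M + 1) => _ [u _ <-]; apply: HM; [rewrite ltrDl | exists u].
Qed.

Lemma sup_norm_le f (M : R) :
  0 <= M -> (forall t, `|f t| <= M) -> sup_norm f <= M.
Proof.
move=> M0 fM; rewrite /sup_norm.
have [->|/set0P ne] := eqVneq [set `|f t| | t in [set: T]] set0.
  by rewrite sup0.
by apply: ge_sup => // _ [t _ <-].
Qed.

Lemma sup_norm_ge0 f : 0 <= sup_norm f.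
Proof.
rewrite /sup_norm.
have [->|/set0P[_ [t _ _]]] := eqVneq [set `|f t| | t in [set: T]] set0.
  by rewrite sup0.
exact: le_trans (normr_ge0 _) (sup_norm_ub f t).
Qed.

Lemma ler_sup_normD f g : sup_norm (f + g) <= sup_norm f + sup_norm g.
Proof.
apply: sup_norm_le => [|t]; first by rewrite addr_ge0 ?sup_norm_ge0.
by rewrite (le_trans (ler_normD _ _))// lerD ?sup_norm_ub.
Qed.

Lemma sup_norm0_eq0 f : sup_norm f = 0 -> f = 0.
Proof.
move=> f0; apply: val_inj; apply/funext => t /=.
by apply/eqP; rewrite -normr_le0 -f0 sup_norm_ub.
Qed.

Lemma sup_normZ (a : R) f : sup_norm (a *: f) = `|a| * sup_norm f.
Proof.
have le b g : sup_norm (b *: g) <= `|b| * sup_norm g.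
  apply: sup_norm_le => [|t]; first by rewrite mulr_ge0 ?sup_norm_ge0.
  by rewrite normrM ler_wpM2l ?sup_norm_ub.
apply/eqP; rewrite eq_le le/=.
have [->|a0] := eqVneq a 0; first by rewrite normr0 mul0r sup_norm_ge0.
have := le a^-1 (a *: f).
by rewrite scalerA mulVf// scale1r normfV ler_pdivlMl ?normr_gt0.
Qed.

HB.instance Definition _ :=
  @Lmodule_isNormed.Build R C sup_norm ler_sup_normD sup_normZ sup_norm0_eq0.

End contfun_theory.

Section operators.
Context (R : realType) (T : topologicalType) (cT : compact [set: T]).
Local Notation C := (contfun R cT).
Implicit Types (f g x y : C) (F : C -> C) (A : {linear C -> C}).

Definition pos_cone : set C := [set f | forall t, 0 <= f t].

Definition ll x y : Prop := pos_cone° (y - x).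

(* The default value 0 is returned when the pointwise power is not continuous;
   by contfun_powE this never happens for a strictly positive x. *)
Definition contfun_pow x (s : R) : C := insubd 0 (fun t => x t `^ s).

Lemma ll0_gt0 x : ll 0 x -> forall t, 0 < x t.
Proof.
rewrite /ll subr0 => /nbhs_ballP[e /= e0 xe] t.
have e20 : 0 < e / 2 by rewrite divr_gt0.
have c1 : (fun=> e / 2) \in @contfun_pred R T.
  by apply: (introT (contfun_predP _)) => u; exact: cvg_cst.
pose c : C := @ContFun R T cT (fun=> e / 2) c1.
have : pos_cone (x - c).
  apply: xe; rewrite -ball_normE /ball_ /= opprB addrC subrK.
  apply: (@le_lt_trans _ _ (e / 2)); last by rewrite ltr_pdivrMr// ltr_pMr// ltr1n.
  by apply: sup_norm_le => [|u]; rewrite ?ger0_norm// ltW.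
by move=> /(_ t) /=; rewrite subr_ge0; exact: lt_le_trans.
Qed.

Lemma contfun_powE x (s : R) :
  ll 0 x -> forall t, contfun_pow x s t = x t `^ s.
Proof.
move=> x0 t; rewrite /contfun_pow.
suff h : (fun t => x t `^ s) \in @contfun_pred R T.
  by have := @insubdK _ _ C 0 _ h => /(congr1 (@^~ t)).
apply: (introT (contfun_predP _)) => u.
apply: (@continuous_comp _ _ _ x (@powR R ^~ s)).
  exact: contfun_continuous.
apply: differentiable_continuous; apply/derivable1_diffP.
by apply: derivable_powR; rewrite in_itv/= andbT ll0_gt0.
Qed.

Definition positive_op F : Prop := forall x, pos_cone x -> pos_cone (F x).

Definition unit_ball : set C := [set x | `|x| <= 1].

Definition eventually_compact F : Prop :=
  exists k : nat, precompact (iter k F @` unit_ball).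

Definition is_ideal (I : set C) : Prop :=
  submod_closed [pred f | f \in I] /\
  forall f g, I g -> (forall t, `|f t| <= `|g t|) -> I f.

Definition irreducible F : Prop :=
  forall I : set C, is_ideal I -> closed I -> F @` I `<=` I ->
    (exists2 f, I f & f != 0) -> I = [set: C].

(* Positive operators on C(T) are bounded, so for them this supremum and the
   limit below exist. *)
Definition op_norm F : R := sup [set `|F x| | x in unit_ball].

Definition spectral_radius F : R :=
  lim ((op_norm (iter k F)) `^ k%:R^-1 @[k --> \oo]).

End operators.

(* Main.v *)
(* With G x = (A x^s)^(1/s), the first equation reads x = G x + b, and G is
   order preserving and positively homogeneous for either sign of s.  If
   v <= (1 + d) u, then G v + b <= (1 + d) (G u + b) - d b, so one application
   of G + b shrinks d by a fixed factor.  This gives uniqueness, and existence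
   as soon as G + b maps an order interval into itself, i.e. as soon as
   G w <= a w for some w >> 0 and a < 1; conversely a solution is such a w.
   For z = w^s the condition is A z <= a^s z if s > 0, and A z >= a^s z with
   a^s > 1 if s < 0.  As r(A) is the limit of |A^k 1|^(1/k), the former amounts
   to r(A) < 1.  The latter amounts to r(A) > 1: for 1 < a < r(A), the
   normalized partial sums z of the divergent series sum_k a^-k A^k 1 satisfy
   A z >= a z up to a small error; a power of A being compact, they yield
   q >= 0, q <> 0 with A q >= a q, and by irreducibility some finite sum of the
   A^j q is strictly positive. *)
Require Import Defs.
From HB Require Import structures.
From mathcomp Require Import all_boot all_order all_algebra.
From mathcomp Require Import all_classical all_reals all_analysis.
From mathcomp Require Import ring lra.

Set Implicit Arguments.
Unset Strict Implicit.
Unset Printing Implicit Defensive.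

Import Order.TTheory GRing.Theory Num.Theory.
Import numFieldNormedType.Exports.

Local Open Scope classical_set_scope.
Local Open Scope ring_scope.

(** * Real powers: inversion, monotonicity, comparison with 1 *)

Section powR_monotone.
Context (R : realType).
Implicit Types a b s r : R.

Lemma powRVK a s : 0 < a -> s != 0 -> (a `^ s) `^ (1 / s) = a.
Proof. by move=> a0 s0; rewrite -powRrM div1r divff// powRr1// ltW. Qed.

Lemma powRKV a s : 0 < a -> s != 0 -> (a `^ (1 / s)) `^ s = a.
Proof. by move=> a0 s0; rewrite powRAC powRVK. Qed.

Lemma lt0_ger_powR s a b : s < 0 -> 0 < a -> a <= b -> b `^ s <= a `^ s.
Proof.
move=> s0 a0 ab; have b0 := lt_le_trans a0 ab.
rewrite -[s]opprK [leLHS]powRN [leRHS]powRN lef_pV2 ?posrE ?powR_gt0//.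
by rewrite ge0_ler_powR ?nnegrE ?oppr_ge0 ?(ltW s0) ?(ltW a0) ?(ltW b0).
Qed.

Lemma gt0_powR_lt1 s r : 0 < s -> 0 < r -> (r `^ s < 1) = (r < 1).
Proof.
move=> s0 r0; rewrite /powR gt_eqF// -[X in _ < X]expR0 ltr_expR pmulr_rlt0//.
by rewrite -(ln1 R) ltr_ln ?posrE.
Qed.

Lemma lt0_powR_lt1 s r : s < 0 -> 0 < r -> (r `^ s < 1) = (1 < r).
Proof.
move=> s0 r0; rewrite /powR gt_eqF// -[X in _ < X]expR0 ltr_expR nmulr_rlt0//.
by rewrite -(ln1 R) ltr_ln ?posrE.
Qed.

End powR_monotone.

(** * Roots of submultiplicative sequences *)

Section fekete.
Context (R : realType).
Implicit Types (p : nat -> R) (a c : R).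

Lemma cvg_root_geometric c a : 0 < c -> 0 < a ->
  (c * a ^+ n) `^ n%:R^-1 @[n --> \oo] --> a.
Proof.
move=> c0 a0.
(* For [n > 0] the root equals [expR (n%:R^-1 * ln c) * a]; the limit is put in the same shape. *)
have -> : a = expR (0 * ln c) * a by rewrite mul0r expR0 mul1r.
apply: (@cvg_trans _ ((expR (n%:R^-1 * ln c) * a) @[n --> \oo])); last first.
  apply: cvgM; last exact: cvg_cst.
  apply: (@cvg_comp _ _ _ (fun n : nat => n%:R^-1 * ln c) (@expR R)).
    apply: cvgM; last exact: cvg_cst.
    by rewrite -cvg_shiftS; exact: cvg_harmonic.
  exact: continuous_expR.
apply: near_eq_cvg; near=> n.
have n0 : n%:R != 0 :> R by rewrite pnatr_eq0 -lt0n; near: n; exists 1%N.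
rewrite mul0r expR0 mul1r powRM ?exprn_ge0 ?(ltW c0) ?(ltW a0)//.
rewrite -powR_mulrn ?(ltW a0)// -powRrM mulfV// powRr1 ?(ltW a0)//.
by rewrite /powR gt_eqF.
Unshelve. all: by end_near. Qed.

Lemma geometric_root_lt p a n : (0 < n)%N -> 0 < p n ->
  p n `^ n%:R^-1 < a -> p n < a ^+ n.
Proof.
move=> n0 pn0 pa; have a0 := le_lt_trans (powR_ge0 _ _) pa.
rewrite -powR_mulrn ?(ltW a0)//.
have -> : p n = (p n `^ n%:R^-1) `^ n%:R.
  by rewrite -powRrM mulVf ?pnatr_eq0 -?lt0n// powRr1 ?(ltW pn0).
by rewrite gt0_ltr_powR ?nnegrE ?powR_ge0 ?ltr0n ?(ltW a0).
Qed.

(** Each block of length [N] peeled off [n] costs a factor at most [a ^+ N]; [c] absorbs the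
    remaining length, which is below [N]. *)
Lemma submultiplicative_geometric_bound p N a : (0 < N)%N -> 0 < a ->
  (forall n, 0 < p n) -> (forall m n, p (m + n)%N <= p m * p n) ->
  p N <= a ^+ N -> exists2 c, 0 < c & forall n, p n <= c * a ^+ n.
Proof.
move=> N0 a0 p0 pM pN.
pose c := \sum_(j < N) p j / a ^+ j.
have tge0 (j : 'I_N) : 0 < p j / a ^+ j by rewrite divr_gt0 ?exprn_gt0.
have cj (j : nat) : (j < N)%N -> p j <= c * a ^+ j.
  move=> jN; rewrite -ler_pdivrMr ?exprn_gt0// /c (bigD1 (Ordinal jN))//=.
  by rewrite lerDl sumr_ge0// => i _; exact: ltW.
exists c => [|n].
  by have := lt_le_trans (p0 0) (cj 0 N0); rewrite expr0 mulr1.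
elim/ltn_ind: n => n IH; case: (ltnP n N) => [/cj//|Nn].
rewrite -(subnKC Nn) (le_trans (pM _ _))// exprD mulrCA.
apply: ler_pM => //; try exact: ltW.
by apply: IH; rewrite ltn_subrL N0 (leq_trans N0 Nn).
Qed.

(** The limit is the infimum of the roots. Some root lies below [a = inf E + e / 2], so
    [p n <= c * a ^+ n] for all [n], and the roots of the right side tend to [a]. *)
Lemma fekete p :
  (forall n, 0 < p n) -> (forall m n, p (m + n)%N <= p m * p n) ->
  exists r : R, p n `^ n%:R^-1 @[n --> \oo] --> r.
Proof.
move=> p0 pM.
(* Index 0 is left out: the inverse of 0 is 0, so the root there is 1. *)
pose E := [set p n `^ n%:R^-1 | n in [set n | (0 < n)%N]].
have hE : has_inf E.
  split; first by exists (p 1 `^ 1%:R^-1), 1%N.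
  by exists 0 => _ [n _ <-]; exact: powR_ge0.
have lb n : (0 < n)%N -> inf E <= p n `^ n%:R^-1.
  by move=> n0; apply: ge_inf; [exact: hE.2 | exists n].
exists (inf E); apply/cvgrPdist_le => e e0.
have e20 : 0 < e / 2 by rewrite divr_gt0.
have [_ [N N0 <-] Ne] := inf_adherent e20 hE.
have a0 := le_lt_trans (powR_ge0 _ _) Ne.
have [c c0 pc] := submultiplicative_geometric_bound N0 a0 p0 pM
  (ltW (geometric_root_lt N0 (p0 N) Ne)).
have := cvgr_lt _ (cvg_root_geometric c0 a0) (inf E + e).
move=> /(_ _)/(_ _)[]; first by rewrite ltrD2l ltr_pdivrMr// ltr_pMr// ltr1n.
move=> M _ HM; near=> n.
have n0 : (0 < n)%N by near: n; exists 1%N.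
rewrite distrC ger0_norm ?subr_ge0 ?lb// lerBlDl.
apply: le_trans (ltW (HM n _)); last by near: n; exists M.
by rewrite ge0_ler_powR ?nnegrE ?invr_ge0 ?ler0n ?pc// ?ltW// mulr_gt0 ?exprn_gt0.
Unshelve. all: by end_near. Qed.

End fekete.

(** * Pointwise order and strict positivity in C(T) *)

Section contfun_order.
Context (R : realType) (T : topologicalType) (cT : compact [set: T]).
Local Notation C := (contfun R cT).
Implicit Types (f g x y : C) (a c e : R) (t : T).

Lemma contfun_eqP f g : (forall t, f t = g t) -> f = g.
Proof. by move=> fg; apply: val_inj; apply/funext. Qed.

Lemma contfunDE f g t : (f + g) t = f t + g t. Proof. by []. Qed.
Lemma contfunNE f t : (- f) t = - f t. Proof. by []. Qed.
Lemma contfunBE f g t : (f - g) t = f t - g t. Proof. by []. Qed.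
Lemma contfunZE a f t : (a *: f) t = a * f t. Proof. by []. Qed.

Lemma contfun_sumE (I : Type) (r : seq I) (P : pred I) (F : I -> C) t :
  (\sum_(i <- r | P i) F i) t = \sum_(i <- r | P i) F i t.
Proof. exact: (big_morph (fun f : C => f t)). Qed.

Lemma norm_contfun_ub f t : `|f t| <= `|f|.
Proof. exact: sup_norm_ub. Qed.

Lemma contfun_le_norm f t : f t <= `|f|.
Proof. exact: le_trans (ler_norm _) (norm_contfun_ub f t). Qed.

Lemma norm_contfun_le f a : 0 <= a -> (forall t, `|f t| <= a) -> `|f| <= a.
Proof. exact: sup_norm_le. Qed.

Lemma cst_contfun_subproof : (fun=> 1) \in @contfun_pred R T.
Proof. by apply/contfun_predP => t; exact: cvg_cst. Qed.

Definition contfun1 : C := ContFun cT cst_contfun_subproof.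

Lemma contfun1E t : contfun1 t = 1. Proof. by []. Qed.

(** The reciprocal of [f] is continuous, hence bounded by its norm. The added 1 covers an empty [T],
    where that norm is 0. *)
Lemma contfun_gt0_lb f : (forall t, 0 < f t) ->
  exists2 c, 0 < c & forall t, c <= f t.
Proof.
move=> f0.
have fV : (fun t => (f t)^-1) \in @contfun_pred R T.
  apply/contfun_predP => t; apply: cvgV; last exact: contfun_continuous.
  by rewrite gt_eqF.
have ub t := norm_contfun_ub (ContFun cT fV) t.
have n1 : 0 < `|ContFun cT fV| + 1 by rewrite ltr_wpDl.
exists (`|ContFun cT fV| + 1)^-1 => [|t]; first by rewrite invr_gt0.
rewrite -[leRHS]invrK lef_pV2 ?posrE ?invr_gt0//.
rewrite (le_trans _ (le_trans (ub t) _)) ?lerDl//=; exact: ler_norm.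
Qed.

(** A positive [f] has a lower bound [c > 0], and the ball of radius [c] around [f] stays in the
    cone. *)
Lemma ll0P f : ll 0 f <-> forall t, 0 < f t.
Proof.
split=> [|f0]; first exact: ll0_gt0.
have [c c0 cf] := contfun_gt0_lb f0.
rewrite /ll subr0; apply/nbhs_ballP; exists c => //= g.
rewrite -ball_normE /ball_ /= => fg t.
have := le_trans (ler_norm _) (norm_contfun_ub (f - g) t).
rewrite contfunBE => /le_lt_trans/(_ fg).
by rewrite ltrBlDl -ltrBlDr => /ltW; apply: le_trans; rewrite subr_ge0.
Qed.

Lemma contfun_dominated f g : (forall t, 0 < g t) ->
  exists2 c, 0 < c & forall t, f t <= c * g t.
Proof.
move=> /contfun_gt0_lb[c c0 cg]; exists ((`|f| + 1) / c) => [|t].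
  by rewrite divr_gt0// ltr_wpDl.
rewrite mulrAC ler_pdivlMr//; apply: (@le_trans _ _ ((`|f| + 1) * c)).
  rewrite ler_pM2r// (le_trans (ler_norm _))// (le_trans (norm_contfun_ub _ _))//.
  by rewrite lerDl.
by rewrite ler_wpM2l ?addr_ge0.
Qed.

End contfun_order.

(** * Vanishing ideals and a compactness bound *)

Section ideals.
Context (R : realType) (T : topologicalType) (cT : compact [set: T]).
Local Notation C := (contfun R cT).
Implicit Types (f g x y : C) (a c e : R) (t : T).

Definition vanishing_ideal (K : set T) : set C :=
  [set f | forall t, K t -> f t = 0].

Lemma is_ideal_vanishing K : is_ideal (vanishing_ideal K).
Proof.
split=> [|f g gK fg t Kt].
  split=> [|a f g /set_mem fK /set_mem gK]; apply/mem_set => t Kt //.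
  by rewrite contfunDE contfunZE fK// gK// mulr0 addr0.
by apply/eqP; rewrite -normr_le0 (le_trans (fg t))// gK// normr0.
Qed.

Lemma closed_vanishing_ideal K : closed (vanishing_ideal K).
Proof.
move=> f clf t Kt; apply/eqP; rewrite -normr_le0; apply/ler_addgt0Pr => e e0; rewrite add0r.
have [g [gK]] := clf _ (nbhsx_ballx f e e0).
rewrite -ball_normE /ball_ /= => /ltW; apply: le_trans.
by have := norm_contfun_ub (f - g) t; rewrite contfunBE gK// subr0.
Qed.

(** Near a point where some [h j] is positive, a large multiple of a partial sum exceeds [|f|]; near
    a common zero, [|f|] is below [e]. As [h] is nonnegative, each local bound persists for larger
    [N], so by compactness one [N] serves everywhere. *)
Lemma compact_seq_bound (h : nat -> C) f e : 0 < e ->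
  (forall j t, 0 <= h j t) -> (forall t, (forall j, h j t = 0) -> f t = 0) ->
  exists N : nat, forall t, `|f t| <= e + N%:R * (\sum_(j < N) h j) t.
Proof.
move=> e0 h0 hf.
suff : \forall N \near \oo, [set: T] `<=`
    [set t | `|f t| <= e + N%:R * (\sum_(j < N) h j) t].
  by move=> [N _ /(_ N (leqnn _)) HN]; exists N => t; exact: HN.
apply: (iffLR (compact_near_coveringP _) cT) => t _.
have [/existsNP[j /eqP hj]|/contrapT/hf ft0] := pselect (~ forall j, h j t = 0).
  have d0 : 0 < h j t / 2 by rewrite divr_gt0// lt_neqAle eq_sym hj h0.
  have : \forall u \near t, h j t / 2 < h j u.
    by apply: (cvgr_gt _ (@contfun_continuous _ _ _ (h j) t));
      rewrite ltr_pdivrMr// ltr_pMr ?ltr1n// lt_neqAle eq_sym hj h0.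
  have [M HM] : exists M : nat, `|f| / (h j t / 2) <= M%:R.
    exists (Num.bound (`|f| / (h j t / 2))).
    by rewrite ltW// archi_boundP// divr_ge0// ltW.
  move=> U.
  (* [j.+1 <= n] puts [h j] among the summands, and [M <= n] makes its coefficient large enough. *)
  exists ([set u | h j t / 2 < h j u], [set n | (maxn M j.+1 <= n)%N]).
    by split=> //; exists (maxn M j.+1).
  move=> [u n] /= [hu]; rewrite geq_max => /andP[Mn jn].
  rewrite (le_trans (norm_contfun_ub f u))// -[leLHS]add0r lerD ?(ltW e0)//.
  rewrite contfun_sumE (bigD1 (Ordinal jn))//= mulrDr -[leLHS]addr0 lerD//.
    rewrite -ler_pdivrMr; last exact: lt_trans hu.
    apply: le_trans (le_trans HM _); last by rewrite ler_nat.
    rewrite ler_wpM2l// lef_pV2 ?posrE//; first exact: ltW.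
    exact: lt_trans hu.
  by rewrite mulr_ge0// sumr_ge0.
have : \forall u \near t, `|f u| < e .
  apply: (cvgr_lt (`|f t|)); last by rewrite ft0 normr0.
  exact: (cvg_norm (@contfun_continuous _ _ _ f t)).
move=> U; exists ([set u | `|f u| < e], setT); first by split=> //; exact: filterT.
move=> [u n] /= [fu _]; rewrite (le_trans (ltW fu))// lerDl mulr_ge0//.
by rewrite contfun_sumE sumr_ge0.
Qed.

End ideals.

(** * Positive operators and irreducibility *)

Section positive_operator.
Context (R : realType) (T : topologicalType) (cT : compact [set: T]).
Local Notation C := (contfun R cT).
Context (A : {linear C -> C}) (A_pos : positive_op A).
Local Notation "1" := (contfun1 R cT) : contfun_scope.
Local Delimit Scope contfun_scope with C.
Local Notation Ak k := (iter k A).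
Implicit Types (f g x y q : C) (a c e : R) (t : T) (k : nat).

Lemma positive_op_mono f g :
  (forall t, f t <= g t) -> forall t, A f t <= A g t.
Proof.
move=> fg t; rewrite -subr_ge0 -contfunBE -linearB.
by apply: A_pos => u; rewrite contfunBE subr_ge0.
Qed.

Lemma iter_pos k f : (forall t, 0 <= f t) -> forall t, 0 <= Ak k f t.
Proof. by move=> f0; elim: k => //= k IH; exact: A_pos. Qed.

Lemma iter_opD k f g : Ak k (f + g) = Ak k f + Ak k g.
Proof. by elim: k => //= k ->; rewrite linearD. Qed.

Lemma iter_opZ k a f : Ak k (a *: f) = a *: Ak k f.
Proof. by elim: k => //= k ->; rewrite linearZ. Qed.

Lemma iter_mono k f g :
  (forall t, f t <= g t) -> forall t, Ak k f t <= Ak k g t.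
Proof. by move=> fg; elim: k => //= k IH; exact: positive_op_mono. Qed.

Lemma iter_dominated k f g :
  (forall t, `|f t| <= g t) -> forall t, `|Ak k f t| <= Ak k g t.
Proof.
move=> fg t; rewrite ler_norml -contfunNE -scaleN1r -iter_opZ scaleN1r.
rewrite !iter_mono// => u; have /ler_normlP[]:= fg u; rewrite ?contfunNE//.
by rewrite lerNl.
Qed.

Lemma iter_le_norm k f t : `|Ak k f t| <= `|f| * Ak k 1%C t.
Proof.
rewrite -contfunZE -iter_opZ; apply: iter_dominated => u.
by rewrite contfunZE mulr1 norm_contfun_ub.
Qed.

(** By positivity [|f| <= 1] gives [|A^k f| <= A^k 1], so the supremum is attained at the constant
    1. *)
Lemma op_norm_iter k : op_norm (Ak k) = `|Ak k 1%C|.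
Proof.
have ub1 : @unit_ball R T cT 1%C.
  by rewrite /unit_ball/=; apply: norm_contfun_le => // t; rewrite normr1.
have ub : ubound [set `|Ak k f| | f in @unit_ball R T cT] `|Ak k 1%C|.
  move=> _ [f f1 <-]; apply: norm_contfun_le => // t.
  rewrite (le_trans (iter_le_norm _ _ _))//.
  rewrite (le_trans _ (norm_contfun_ub _ t))// (le_trans _ (ler_norm _))//.
  by rewrite ler_piMl// iter_pos.
apply/eqP; rewrite eq_le; apply/andP; split.
  by apply: ge_sup ub; exists `|Ak k 1%C|, 1%C.
by apply: ub_le_sup; [exists `|Ak k 1%C| | exists 1%C].
Qed.

(** The functions vanishing on [K] form a closed invariant ideal, nonzero because of [f]. It
    therefore contains the constant 1, which has no zero. *)
Lemma irreducible_vanishing (K : set T) f :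
  irreducible A -> (forall t, K t -> f t = 0) -> f != 0 ->
  (forall g, (forall t, K t -> g t = 0) -> forall t, K t -> A g t = 0) ->
  forall t, ~ K t.
Proof.
move=> irrA fK f0 AK t Kt.
have : vanishing_ideal (cT := cT) K = [set: C].
  apply: irrA; [exact: is_ideal_vanishing | exact: closed_vanishing_ideal | |].
    by move=> _ [g gK <-]; exact: AK.
  by exists f.
move=> /seteqP[_ /(_ 1%C I)] /(_ t Kt) /eqP; apply/negP.
by rewrite contfun1E oner_neq0.
Qed.

(** Where [A 1] vanishes, so does every [A f]. The ideal of functions vanishing there is thus
    invariant and contains the nonzero [A x]. *)
Lemma irreducible_op1_gt0 : irreducible A -> (exists x, A x != 0) ->
  forall t, 0 < A 1%C t.
Proof.
move=> irrA [x Ax0] t.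
have A1K f u : A 1%C u = 0 -> A f u = 0.
  move=> u0; apply/eqP; rewrite -normr_le0.
  by have := iter_le_norm 1 f u; rewrite /= u0 mulr0.
rewrite lt_neqAle eq_sym A_pos ?andbT//; apply/eqP.
apply: (irreducible_vanishing (K := [set u | A 1%C u = 0]) (f := A x)) => //.
- by move=> u /= /A1K.
- by move=> g _ u /= /A1K.
Qed.

(** The common zeros of all [A^j q] have an invariant vanishing ideal, so there are none;
    compactness then reduces to finitely many [j]. *)
Lemma irreducible_sum_iter_gt0 q : irreducible A ->
  (forall t, 0 <= q t) -> q != 0 ->
  exists N, forall t, 0 < (\sum_(j < N) Ak j q) t.
Proof.
move=> irrA q0 qn0.
have h0 j t : 0 <= Ak j q t by exact: iter_pos.
have K0 : forall t, ~ (forall j, Ak j q t = 0).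
  apply: (irreducible_vanishing (K := fun t => forall j, Ak j q t = 0) (f := q)) => //.
    by move=> t /(_ 0%N).
  move=> g gK t Kt; apply/eqP; rewrite -normr_le0; apply/ler_addgt0Pr => e e0.
  have A1 : 0 < A 1%C t + 1 by rewrite ltr_wpDl// A_pos.
  have [N gN] := compact_seq_bound (divr_gt0 e0 A1) h0 gK.
  (* [d] dominates [|g|]. At a common zero [t] the terms [A^(j+1) q] vanish, so only the constant
     part contributes to [A d t], and its scaling keeps that at most [e]. *)
  pose d := (e / (A 1%C t + 1)) *: 1%C + N%:R *: (\sum_(j < N) Ak j q).
  have Ad : A d t = e / (A 1%C t + 1) * A 1%C t.
    have -> : A d = (e / (A 1%C t + 1)) *: A 1%C + N%:R *: \sum_(j < N) Ak j.+1 q.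
      by rewrite /d linearD !linearZ/= linear_sum.
    rewrite contfunDE !contfunZE contfun_sumE big1 => [|j _]; last exact: Kt.
    by rewrite mulr0 addr0.
  rewrite add0r (le_trans (iter_dominated 1 (g := d) _ t))// => [u|].
    by rewrite contfunDE !contfunZE mulr1.
  rewrite Ad.
  by rewrite mulrAC ler_pdivrMr// ler_wpM2l ?(ltW e0)// lerDl.
(* Without common zeros the bound applies to the constant 1 with [e = 1/2]; a zero of the sum would
   give [1 <= 1/2]. *)
have [N HN] := compact_seq_bound (f := 1%C) (e := 2^-1) (h := fun j => Ak j q)
  ltac:(by rewrite invr_gt0) h0 (fun t Kt => False_ind _ (K0 t Kt)).
exists N => t; rewrite lt_neqAle contfun_sumE sumr_ge0// andbT.
rewrite -contfun_sumE; apply/eqP => s0; have := HN t.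
rewrite -s0 mulr0 addr0 normr1 leNgt invf_lt1 ?ltr1n//.
Qed.

End positive_operator.

(** * The spectral radius compared with 1 through strictly positive functions *)

Section spectral_radius.
Context (R : realType) (T : topologicalType) (cT : compact [set: T]).
Local Notation C := (contfun R cT).
Context (A : {linear C -> C}) (A_pos : positive_op A).
Context (T0 : [set: T] !=set0) (irrA : irreducible A).
Context (A_neq0 : exists x, A x != 0).
Local Notation "1" := (contfun1 R cT) : contfun_scope.
Local Delimit Scope contfun_scope with C.
Local Notation Ak k := (iter k A).
Implicit Types (f g x y z q : C) (a c e : R) (t : T) (k : nat).

Lemma op1_lb : exists2 c, 0 < c & forall f a, 0 <= a ->
  (forall t, a <= f t) -> forall t, a * c <= A f t.
Proof.
have [c c0 cA] := contfun_gt0_lb (irreducible_op1_gt0 A_pos irrA A_neq0).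
exists c => // f a a0 af t; apply: (@le_trans _ _ (A (a *: 1%C) t)).
  by rewrite linearZZ contfunZE ler_wpM2l.
by apply: positive_op_mono => // u; rewrite contfunZE mulr1.
Qed.

Lemma iter1_lb : exists2 c, 0 < c & forall k t, c ^+ k <= Ak k 1%C t.
Proof.
have [c c0 cA] := op1_lb; exists c => //; elim=> [|k IH] t; first by rewrite expr0.
by rewrite exprSr /=; apply: cA => //; rewrite exprn_ge0 ?ltW.
Qed.

Lemma norm_iter1_gt0 k : 0 < `|Ak k 1%C|.
Proof.
have [c c0 /(_ k) ck] := iter1_lb; have [t _] := T0.
apply: lt_le_trans (le_trans (ck t) _); first by rewrite exprn_gt0.
exact: contfun_le_norm.
Qed.

Lemma norm_iter1M m n : `|Ak (m + n) 1%C| <= `|Ak m 1%C| * `|Ak n 1%C|.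
Proof.
apply: norm_contfun_le => [|t]; first by rewrite mulr_ge0.
rewrite iterD (le_trans (iter_le_norm A_pos _ _ _))// mulrC ler_wpM2r//.
exact: contfun_le_norm.
Qed.

(** The norms of [A^k 1] are positive and submultiplicative, so [fekete] makes the [lim] in the
    definition a genuine limit. *)
Lemma cvg_spectral_radius :
  `|Ak k 1%C| `^ k%:R^-1 @[k --> \oo] --> spectral_radius A.
Proof.
have [r r_lim] := fekete norm_iter1_gt0 norm_iter1M.
rewrite /spectral_radius.
have -> : (fun k => op_norm (Ak k) `^ k%:R^-1) =
    (fun k => `|Ak k 1%C| `^ k%:R^-1).
  by apply/funext => k; rewrite op_norm_iter.
by rewrite (cvg_lim (@Rhausdorff R) r_lim).
Qed.

Lemma spectral_radius_ge a c : 0 < c -> 0 < a ->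
  (forall k, c * a ^+ k <= `|Ak k 1%C|) -> a <= spectral_radius A.
Proof.
move=> c0 a0 ca.
apply: ler_cvg_to (cvg_root_geometric c0 a0) cvg_spectral_radius _.
near=> n; rewrite ge0_ler_powR ?nnegrE//.
by rewrite mulr_ge0 ?exprn_ge0 ?ltW.
Unshelve. all: by end_near. Qed.

Lemma spectral_radius_le a c : 0 < c -> 0 < a ->
  (forall k, `|Ak k 1%C| <= c * a ^+ k) -> spectral_radius A <= a.
Proof.
move=> c0 a0 ca.
apply: ler_cvg_to cvg_spectral_radius (cvg_root_geometric c0 a0) _.
near=> n; rewrite ge0_ler_powR ?nnegrE//.
by rewrite mulr_ge0 ?exprn_ge0 ?ltW.
Unshelve. all: by end_near. Qed.

Lemma spectral_radius_gt0 : 0 < spectral_radius A.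
Proof.
have [c c0 ck] := iter1_lb; apply: lt_le_trans (c0) _.
apply: (@spectral_radius_ge c 1) => // k; rewrite mul1r; have [t _] := T0.
exact: le_trans (ck k t) (contfun_le_norm _ _).
Qed.

(** From [z], iteration gives [A^k z <= a^k z], and [1 <= c z] turns this into a bound on [A^k 1].
    Conversely, for [r(A) < a < 1], a truncated Neumann series of terms [h k = a^-k A^k 1] works:
    [a z - A z] telescopes to [a (h 0 - h N.+1)]. *)
Lemma spectral_radius_lt1P :
  (exists (z : C) (a : R), [/\ forall t, 0 < z t, 0 < a < 1 & forall t, A z t <= a * z t])
  <-> spectral_radius A < 1.
Proof.
split=> [[z [a [z0 /andP[a0 a1] Az]]]|r1].
  apply: le_lt_trans a1; have [c c0 cz] := contfun_dominated 1%C z0.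
  have [t0 _] := T0.
  have zn : 0 < `|z|.
    exact: lt_le_trans (z0 t0) (contfun_le_norm _ _).
  have Akz k t : Ak k z t <= a ^+ k * z t.
    elim: k t => [|k IH] t; first by rewrite expr0 mul1r.
    have := positive_op_mono A_pos (g := a ^+ k *: z) IH t.
    by rewrite linearZZ contfunZE exprSr -mulrA => /le_trans; apply;
      rewrite ler_wpM2l ?exprn_ge0 ?(ltW a0).
  apply: (@spectral_radius_le a (c * `|z|)) => // [|k]; first exact: mulr_gt0.
  apply: norm_contfun_le => [|t]; first by rewrite !mulr_ge0 ?exprn_ge0 ?ltW.
  rewrite ger0_norm ?iter_pos//.
  have := iter_mono A_pos k (f := 1%C) (g := c *: z) cz t.
  rewrite iter_opZ contfunZE => /le_trans; apply; rewrite -mulrA ler_pM2l//.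
  rewrite (le_trans (Akz k t))// mulrC ler_wpM2r ?exprn_ge0 ?(ltW a0)//.
  exact: contfun_le_norm.
pose a := (spectral_radius A + 1) / 2.
have r0 := spectral_radius_gt0.
have ra : spectral_radius A < a by rewrite /a; lra.
have a1 : a < 1 by rewrite /a; lra.
have a0 : 0 < a by exact: lt_trans ra.
(* [N.+1] is nonzero, so the root can be undone; it is also the index left over by the telescoping
   sum. *)
have [N _ /(_ N.+1 (leqnSn _)) HN] := cvgr_lt _ cvg_spectral_radius _ ra.
have {}HN := geometric_root_lt (p := fun k => `|Ak k 1%C|) (ltn0Sn N) (norm_iter1_gt0 _) HN.
pose h k := (a ^+ k)^-1 *: Ak k 1%C.
have h0 k t : 0 <= h k t.
  by rewrite contfunZE mulr_ge0 ?iter_pos ?invr_ge0 ?exprn_ge0 ?ltW.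
exists (\sum_(k < N.+1) h k), a; split; [|by rewrite a0|] => t.
  rewrite contfun_sumE big_ord_recl ltr_wpDr ?sumr_ge0//.
  by rewrite contfunZE expr0 invr1 mul1r.
have -> : A (\sum_(k < N.+1) h k) = a *: \sum_(k < N.+1) h k.+1.
  rewrite linear_sum scaler_sumr; apply: eq_bigr => k _; rewrite linearZZ scalerA.
  by rewrite exprS invfM mulrA mulfV ?gt_eqF// mul1r.
rewrite contfunZE ler_pM2l// !contfun_sumE -subr_ge0 -sumrB.
rewrite -(big_mkord xpredT (fun k => h k t - h k.+1 t)).
have -> : \sum_(0 <= k < N.+1) (h k t - h k.+1 t) = h 0 t - h N.+1 t.
  rewrite -[RHS]opprB -(telescope_sumr (h^~ t))// -sumrN.
  by apply: eq_bigr => k _; rewrite opprB.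
rewrite subr_ge0 !contfunZE expr0 invr1 mul1r contfun1E.
rewrite mulrC ler_pdivrMr ?exprn_gt0// mul1r.
exact: le_trans (contfun_le_norm _ _) (ltW HN).
Qed.

(** If all partial sums had norm at most [a / e], so would every term [a^-k A^k 1], forcing
    [r(A) <= a]. For a sum [w] of larger norm, telescoping gives [a w - A w <= a], and normalizing
    brings the error below [e]. *)
Lemma approx_subeigenvector a e : 0 < a -> a < spectral_radius A -> 0 < e ->
  exists z, [/\ forall t, 0 <= z t, `|z| = 1 &
    forall t, a * z t <= A z t + e].
Proof.
move=> a0 ar e0.
pose h k := (a ^+ k)^-1 *: Ak k 1%C.
have h0 k t : 0 <= h k t.
  by rewrite contfunZE mulr_ge0 ?iter_pos ?invr_ge0 ?exprn_ge0 ?ltW.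
pose w N := \sum_(k < N) h k.
have w0 N t : 0 <= w N t by rewrite contfun_sumE sumr_ge0.
have [N wN] : exists N, a / e < `|w N|.
  apply: contrapT => /forallNP wle; move: ar; apply/negP; rewrite -leNgt.
  have {}wle N : `|w N| <= a / e by rewrite leNgt; apply/negP; exact: wle.
  apply: (@spectral_radius_le a (a / e)) => // [|k]; first exact: divr_gt0.
  rewrite -ler_pdivrMr ?exprn_gt0// (le_trans _ (wle k.+1))// mulrC.
  have -> : (a ^+ k)^-1 * `|Ak k 1%C| = `|h k|.
    by rewrite normrZ ger0_norm// invr_ge0 exprn_ge0// ltW.
  apply: norm_contfun_le => // t; rewrite ger0_norm//.
  apply: le_trans (contfun_le_norm _ t).
  by rewrite /w contfun_sumE big_ord_recr lerDr sumr_ge0.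
have wN0 : 0 < `|w N| by apply: lt_trans wN; exact: divr_gt0.
exists (`|w N|^-1 *: w N); split=> [t||t].
- by rewrite contfunZE mulr_ge0 ?invr_ge0.
- by rewrite normrZ normfV normr_id mulVf ?gt_eqF.
rewrite linearZZ !contfunZE mulrCA -lerBlDl -mulrBr ler_pdivrMl//.
have -> : A (w N) = a *: \sum_(k < N) h k.+1.
  rewrite linear_sum scaler_sumr; apply: eq_bigr => k _; rewrite linearZZ scalerA.
  by rewrite exprS invfM mulrA mulfV ?gt_eqF// mul1r.
rewrite contfunZE -mulrBr (le_trans (y := a)) //; last first.
  by move: wN; rewrite ltr_pdivrMr// => /ltW.
rewrite -[leRHS]mulr1 ler_pM2l// lerBlDl !contfun_sumE.
have <- : h 0 t = 1 by rewrite contfunZE expr0 invr1 mul1r.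
rewrite [leRHS]addrC; have <- : \sum_(k < N.+1) h k t = h 0 t + \sum_(k < N) h k.+1 t.
  exact: big_ord_recl.
by rewrite big_ord_recr lerDl.
Qed.

Lemma iter_subeigenvector k a e z : 0 < a -> 0 <= e ->
  (forall t, a * z t <= A z t + e) ->
  forall t, a * Ak k z t <= A (Ak k z) t + e * `|Ak k 1%C|.
Proof.
move=> a0 e0 az t.
have := iter_mono A_pos k (f := a *: z) (g := A z + e *: 1%C) _ t.
rewrite iter_opD !iter_opZ contfunDE !contfunZE -iterSr.
move=> /(_ _)/le_trans; apply=> [u|].
  by rewrite contfunDE !contfunZE mulr1.
rewrite lerD2l ler_wpM2l//.
exact: contfun_le_norm.
Qed.

(** A lower bound for the norm of [A^k z], with [c] independent of [z] and [e]: it keeps limits of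
    the functions [A^k z] away from 0. *)
Lemma norm_iter_subeigenvector k a : 0 < a ->
  exists2 c, 0 <= c & forall z e, 0 <= e ->
    (forall t, 0 <= z t) -> (forall t, a * z t <= A z t + e) ->
    a ^+ k * `|z| <= `|Ak k z| + c * e.
Proof.
move=> a0; elim: k => [|k [c c0 IH]].
  by exists 0 => // z e _ _ _; rewrite expr0 !mul1r mul0r addr0.
exists (a * c + `|Ak k 1%C|) => [|z e e0 z0 az].
  by rewrite addr_ge0 ?mulr_ge0 // ltW.
rewrite exprS -mulrA (le_trans (ler_wpM2l (ltW a0) (IH _ _ e0 z0 az)))//.
suff : a * `|Ak k z| <= `|Ak k.+1 z| + e * `|Ak k 1%C| by move=> H; lra.
rewrite -ler_pdivlMl//; apply: norm_contfun_le => [|t].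
  by rewrite mulr_ge0 ?invr_ge0 ?(ltW a0) ?addr_ge0 ?mulr_ge0.
rewrite ler_pdivlMl// ger0_norm ?iter_pos//.
rewrite (le_trans (iter_subeigenvector k a0 e0 az t))// lerD2r.
exact: contfun_le_norm.
Qed.

Lemma precompact_seq_cluster (S : set C) (u : nat -> C) :
  precompact S -> (forall n, S (u n)) ->
  exists q, forall e M, 0 < e -> exists2 n, (M <= n)%N & `|q - u n| < e.
Proof.
rewrite precompactE => cS uS.
have [|q [_ uq]] := cS (u n @[n --> \oo]) _.
  by exists 0%N => // n _; exact: subset_closure.
exists q => e M e0.
have [|_ [[n Mn <-] qn]] := uq (u @` [set n | (M <= n)%N]) _ _ (nbhsx_ballx q e e0).
  by exists M => // n Mn; exists n.
by exists n => //; move: qn; rewrite -ball_normE.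
Qed.

Lemma subeigenvector a : eventually_compact A ->
  1 <= a -> a < spectral_radius A ->
  exists q, [/\ forall t, 0 <= q t, q != 0 & forall t, a * q t <= A q t].
Proof.
move=> [k Ak_cpt] a1 ar; have a0 : 0 < a by exact: lt_le_trans a1.
have eps_pos n : 0 < n.+1%:R^-1 :> R by rewrite invr_gt0.
have /choice[z zP] n := approx_subeigenvector a0 ar (eps_pos n).
have [n|q qP] := precompact_seq_cluster (u := fun n => Ak k (z n)) Ak_cpt.
  by exists (z n) => //; have [_ z1 _] := zP n; rewrite /unit_ball/= z1.
(* An index [n] above [1 / e] makes the error [1 / (n + 1)] at most [e], so one [e] controls both
   error and distance. *)
have {}qP e : 0 < e -> exists x, [/\ forall t, 0 <= x t, `|x| = 1,
    forall t, a * x t <= A x t + e & `|q - Ak k x| < e].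
  move=> e0; have [n Mn qn] := qP e (Num.bound e^-1) e0.
  have [z0 z1 az] := zP n; exists (z n); split=> // t.
  rewrite (le_trans (az t))// lerD2l -[leRHS]invrK lef_pV2 ?posrE ?invr_gt0//.
  rewrite (le_trans (ltW (archi_boundP _))) ?invr_ge0 ?(ltW e0)//.
  by rewrite ler_nat leqW.
have dist x t : `|q t - Ak k x t| <= `|q - Ak k x|.
  by rewrite -contfunBE norm_contfun_ub.
exists q; split=> [t||t].
- apply/ler_addgt0Pr => e e0; have [x [x0 _ _ xq]] := qP e e0.
  have := le_lt_trans (dist x t) xq; rewrite ltr_norml => /andP[+ _].
  by have := iter_pos A_pos k x0 t; lra.
(* With [d = 1 / (2 (1 + c))], the case [q = 0] would give [1 <= a^k <= |A^k x| + c d < (1 + c) d =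
   1/2]. *)
- apply/eqP => q0; have [c c0 cP] := norm_iter_subeigenvector k a0.
  have c1 : 0 < 1 + c by rewrite ltr_pwDl.
  have d0 : 0 < (2 * (1 + c))^-1 by rewrite invr_gt0 mulr_gt0.
  have [x [x0 x1 ax]] := qP _ d0; rewrite q0 sub0r normrN => xd.
  have := cP x _ (ltW d0) x0 ax; rewrite x1 mulr1.
  have : 1 <= a ^+ k by rewrite exprn_ege1.
  have : (2 * (1 + c))^-1 * (1 + c) = 2^-1 by field; rewrite gt_eqF.
  by move: xd; set d := (2 * _)^-1; lra.
- apply/ler_addgt0Pr => e e0.
  (* [D] adds up three errors per unit: replacing [q] by [A^k x] on the left, the same under [A],
     and the defect of [A^k x]. *)
  pose D := a + `|A 1%C| + `|Ak k 1%C|.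
  have D0 : 0 < D by rewrite /D -addrA ltr_pwDl// addr_ge0.
  have d0 : 0 < e / D by rewrite divr_gt0.
  have [x [x0 _ ax xq]] := qP _ d0.
  have := iter_subeigenvector k a0 (ltW d0) ax t.
  have := iter_le_norm A_pos 1 (q - Ak k x) t.
  have -> : iter 1 A (q - Ak k x) = A q - A (Ak k x) by exact: linearB.
  rewrite contfunBE => /ler_normlP[+ _].
  have := le_lt_trans (dist x t) xq; rewrite ltr_norml => /andP[_].
  rewrite -(ltr_pM2l a0) => aq.
  have : `|q - Ak k x| * iter 1 A 1%C t <= e / D * `|A 1%C|.
    apply: ler_pM; rewrite ?(ltW xq)//; first exact: iter_pos.
    exact: contfun_le_norm.
  have : e = e / D * a + e / D * `|A 1%C| + e / D * `|Ak k 1%C|.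
    by rewrite -!mulrDr divfK ?gt_eqF.
  by move: aq; set d := e / D; lra.
Qed.

(** From [z], iteration gives [A^k z >= a^k z], and [d <= z <= c] bounds [A^k 1] below by a multiple
    of [a^k]. Conversely, summing iterates of [q] keeps [a q <= A q], since iterates preserve order,
    and makes the function strictly positive. *)
Lemma spectral_radius_gt1P : eventually_compact A ->
  (exists (z : C) (a : R), [/\ forall t, 0 < z t, 1 < a & forall t, a * z t <= A z t])
  <-> 1 < spectral_radius A.
Proof.
move=> A_cpt; split=> [[z [a [z0 a1 Az]]]|r1].
  have a0 := lt_trans ltr01 a1; apply: lt_le_trans a1 _.
  have [c c0 cz] := contfun_dominated z (g := 1%C) (fun=> ltr01).
  have [d d0 dz] := contfun_gt0_lb z0; have [t _] := T0.
  have Akz k u : a ^+ k * z u <= Ak k z u.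
    elim: k u => [|k IH] u; first by rewrite expr0 mul1r.
    have := positive_op_mono A_pos (f := a ^+ k *: z) IH u.
    rewrite linearZZ contfunZE exprSr -mulrA; apply: le_trans.
    by rewrite ler_wpM2l ?exprn_ge0 ?(ltW a0).
  apply: (@spectral_radius_ge a (d / c)) => // [|k]; first exact: divr_gt0.
  rewrite mulrAC ler_pdivrMr// mulrC.
  apply: (@le_trans _ _ (c * Ak k 1%C t)); last first.
    rewrite mulrC ler_wpM2r ?(ltW c0)//.
    exact: contfun_le_norm.
  rewrite -contfunZE -iter_opZ (le_trans _ (iter_mono A_pos k (g := c *: 1%C) cz t))//.
  by rewrite (le_trans _ (Akz k t))// ler_wpM2l ?exprn_ge0 ?(ltW a0).
pose a := (spectral_radius A + 1) / 2.
have ra : a < spectral_radius A by rewrite /a; lra.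
have a1 : 1 < a by rewrite /a; lra.
have [q [q0 qn0 aq]] := subeigenvector A_cpt (ltW a1) ra.
have [N Nq] := irreducible_sum_iter_gt0 A_pos irrA q0 qn0.
exists (\sum_(j < N) Ak j q), a; split=> // t.
rewrite linear_sum !contfun_sumE mulr_sumr; apply: ler_sum => j _.
by rewrite -contfunZE -iter_opZ -iterS iterSr iter_mono.
Qed.

End spectral_radius.

(** * Fixed points of a monotone homogeneous map plus a constant *)

Lemma ler_addgeometric (R : realType) (x y c k : R) : 0 <= k < 1 ->
  (forall n, x <= y + c * k ^+ n) -> x <= y.
Proof.
move=> /andP[k0 k1] xy; have k1' : `|k| < 1 by rewrite ger0_norm.
have H1 : (fun=> x) n @[n --> \oo] --> x by exact: cvg_cst.
have H2 : y + geometric c k n @[n --> \oo] --> y.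
  by rewrite -[y in _ --> y]addr0; apply: cvgD; [exact: cvg_cst | exact: cvg_geometric].
by apply: ler_cvg_to H1 H2 _; near=> n; exact: xy.
Unshelve. all: by end_near. Qed.

Section homogeneous_plus_constant.
Context (R : realType) (T : topologicalType) (cT : compact [set: T]).
Local Notation C := (contfun R cT).
Context (G : C -> C) (b : C).
Implicit Types (f g x y u v w : C) (a c k : R) (t : T).
Hypothesis b_gt0 : forall t, 0 < b t.
Hypothesis G_gt0 : forall f, (forall t, 0 < f t) -> forall t, 0 < G f t.
Hypothesis G_mono : forall f g, (forall t, 0 < f t) ->
  (forall t, f t <= g t) -> forall t, G f t <= G g t.
Hypothesis G_hom : forall a f, 0 < a -> (forall t, 0 < f t) ->
  G (a *: f) = a *: G f.

Let F f := G f + b.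

Let F_gt0 f : (forall t, 0 < f t) -> forall t, 0 < F f t.
Proof. by move=> f0 t; rewrite contfunDE addr_gt0 ?G_gt0. Qed.

Let F_mono f g : (forall t, 0 < f t) -> (forall t, f t <= g t) ->
  forall t, F f t <= F g t.
Proof. by move=> f0 fg t; rewrite !contfunDE lerD2r G_mono. Qed.

Lemma homogeneous_contraction u v d k : 0 <= d ->
  (forall t, 0 < u t) -> (forall t, 0 < v t) ->
  (forall t, v t <= (1 + d) * u t) -> (forall t, (1 - k) * F u t <= b t) ->
  forall t, F v t <= (1 + d * k) * F u t.
Proof.
move=> d0 u0 v0 vu ub t.
have d1 : 0 < 1 + d by rewrite ltr_wpDr.
have := G_mono (g := (1 + d) *: u) v0 vu t.
have := ler_wpM2l d0 (ub t).
by rewrite G_hom// /F !contfunDE contfunZE; lra.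
Qed.

Lemma homogeneous_fixpoint_le x y :
  (forall t, 0 < x t) -> x = F x -> (forall t, 0 < y t) -> y = F y ->
  forall t, x t <= y t.
Proof.
move=> x0 xF y0 yF t.
have [d d0 xy] := contfun_dominated x y0.
have [c c0 yb] := contfun_dominated y b_gt0.
have c1 : 0 < 1 + c by rewrite ltr_pwDl// ltW.
(* [y <= c b] yields [(1 - k) y <= b]; using [1 + c] keeps [k] in the interval from 0 to 1. *)
pose k := 1 - (1 + c)^-1.
have k1 : 0 <= k < 1.
  by rewrite /k subr_ge0 invf_le1// lerDl (ltW c0) ltrBlDr ltrDl invr_gt0.
have kb p : (1 - k) * y p <= b p.
  rewrite /k opprB addrC subrK ler_pdivrMl// (le_trans (yb p))//.
  by rewrite ler_pM2r// lerDr.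
apply: (ler_addgeometric (c := d * y t) k1) => n.
have {}xy m p : x p <= (1 + d * k ^+ m) * y p.
  elim: m p => [|m IH] p.
    by rewrite expr0 mulr1 (le_trans (xy p))// ler_pM2r// lerDr.
  rewrite exprSr mulrA [x]xF [y in leRHS]yF; apply: homogeneous_contraction => //.
    by rewrite mulr_ge0 ?exprn_ge0 ?(ltW d0)//; case/andP: k1.
  by move=> q; rewrite -yF.
by rewrite (le_trans (xy n t))// mulrDl mul1r mulrAC.
Qed.

(** The pointwise supremum of the [u n] lies within [c * k ^+ n] of the continuous [u n], uniformly
    in [t], hence is continuous. *)
Lemma squeezed_contfun (u v : nat -> C) c k : 0 <= k < 1 ->
  (forall n t, u n t <= u n.+1 t) -> (forall n t, v n.+1 t <= v n t) ->
  (forall n t, u n t <= v n t) -> (forall n t, v n t <= u n t + c * k ^+ n) ->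
  exists x : C, forall n t, u n t <= x t <= v n t.
Proof.
move=> k1 uS vS uv vu.
have u_nd t : {homo (fun n => u n t) : m n / (m <= n)%N >-> m <= n}.
  by apply/nondecreasing_seqP => n; exact: uS.
have v_ni t : {homo (fun n => v n t) : m n / (m <= n)%N >-> n <= m}.
  by apply/nonincreasing_seqP => n; exact: vS.
have uv' t m n : u m t <= v n t.
  rewrite (le_trans (u_nd t _ _ (leq_maxl m n)))// (le_trans (uv _ _))//.
  exact/v_ni/leq_maxr.
pose x t := sup [set u n t | n in [set: nat]].
have xP n t : u n t <= x t <= v n t.
  apply/andP; split.
    by apply: ub_le_sup; [exists (v 0 t) => _ [m _ <-] | exists n].
  by apply: ge_sup; [exists (u 0 t), 0%N | move=> _ [m _ <-]].
suff xc : x \in @contfun_pred R T by exists (ContFun cT xc).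
apply/contfun_predP => t; apply/cvgrPdist_lt => e e0.
have e3 : 0 < e / 3 by rewrite divr_gt0.
have [n cn] : exists n, c * k ^+ n < e / 3.
  apply: contrapT => /forallNP H.
  have := @ler_addgeometric R (e / 3) 0 c k k1; rewrite leNgt e3 => /(_ _)/notF; apply.
  by move=> n; rewrite add0r leNgt; apply/negP; exact: H.
near=> s.
have : `|u n t - u n s| < e / 3.
  near: s; have /cvgrPdist_lt := @contfun_continuous _ _ _ (u n) t.
  exact.
have := xP n t; have := xP n s; have := vu n t; have := vu n s.
rewrite !ltr_norml; lra.
Unshelve. all: by end_near. Qed.

Lemma homogeneous_fixpointP : [set: T] !=set0 ->
  (exists! x, ll 0 x /\ x = G x + b) <->
  exists (w : C) (a : R), [/\ forall t, 0 < w t, 0 < a < 1 & forall t, G w t <= a * w t].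
Proof.
move=> [t0 _]; split=> [[x [[/ll0P x0 xF] _]]|[w [a [w0 /andP[a0 a1] Gw]]]].
  have [c c0 xb] := contfun_dominated x b_gt0.
  have c1 : 0 < 1 + c by rewrite ltr_pwDl// ltW.
  (* As [b >= x / (1 + c)], the equation gives [G x = x - b <= (1 - 1 / (1 + c)) x]. *)
  exists x, (1 - (1 + c)^-1); split=> //.
    by rewrite subr_gt0 invf_lt1// ltrDl c0 ltrBlDr ltrDl invr_gt0.
  move=> t; have /(congr1 (fun f : C => f t)) := xF; rewrite contfunDE => xt.
  suff : (1 + c)^-1 * x t <= b t by lra.
  rewrite ler_pdivrMl// (le_trans (xb t))//.
  by rewrite ler_pM2r// lerDr.
suff [x x0 xF] : exists2 x : C, forall t, 0 < x t & x = F x.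
  exists x; split=> [|y [/ll0P y0 yF]]; first by split=> //; exact/ll0P.
  apply: contfun_eqP => t; apply/eqP.
  by rewrite eq_le !homogeneous_fixpoint_le.
have [c c0 bw] := contfun_dominated b w0.
(* This scaling turns [b <= c w] into [b <= (1 - a) v0], whence [F v0 <= a v0 + (1 - a) v0 = v0]. *)
pose r := c / (1 - a).
have r0 : 0 < r by rewrite divr_gt0// subr_gt0.
pose v0 := r *: w.
have v0_gt0 t : 0 < v0 t by rewrite contfunZE mulr_gt0.
have bv0 t : b t <= (1 - a) * v0 t.
  by rewrite contfunZE mulrA mulrCA mulfV ?mulr1// subr_eq0 gt_eqF.
have Fv0 t : F v0 t <= v0 t.
  rewrite contfunDE G_hom// contfunZE.
  have := ler_wpM2l (ltW r0) (Gw t); have := bv0 t; rewrite contfunZE; lra.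
have bv0' t : b t <= v0 t.
  by rewrite (le_trans (bv0 t))// ler_piMl ?(ltW (v0_gt0 t))// lerBlDr lerDl ltW.
have [d d0 vb] := contfun_dominated v0 b_gt0.
have d1 : 0 < 1 + d by rewrite ltr_pwDl// ltW.
pose k := 1 - (1 + d)^-1.
have k1 : 0 <= k < 1.
  by rewrite /k subr_ge0 invf_le1// lerDl (ltW d0) ltrBlDr ltrDl invr_gt0.
have kb t : (1 - k) * v0 t <= b t.
  rewrite /k opprB addrC subrK ler_pdivrMl// (le_trans (vb t))//.
  by rewrite ler_pM2r// lerDr.
(* [b <= F b] and [F v0 <= v0] make [u] increase and [v] decrease; [b <= v0] keeps [u] below [v]. *)
pose u n := iter n F b; pose v n := iter n F v0.
have u_gt0 n t : 0 < u n t by elim: n t => //= n IH; exact: F_gt0.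
have v_gt0 n t : 0 < v n t by elim: n t => //= n IH; exact: F_gt0.
have uS n t : u n t <= u n.+1 t.
  elim: n t => [|n IH] t; last exact: (F_mono (u_gt0 n) IH).
  by rewrite -[leRHS]/((G b + b) t) contfunDE lerDr ltW// G_gt0.
have vS n t : v n.+1 t <= v n t.
  elim: n t => [|n IH] t; last exact: (F_mono (v_gt0 n.+1) IH).
  exact: Fv0.
have uv n t : u n t <= v n t.
  elim: n t => [|n IH] t; last exact: (F_mono (u_gt0 n) IH).
  exact: bv0'.
have vv0 n t : v n t <= v0 t.
  by elim: n => [|n]; [exact: lexx | exact: le_trans].
have vu n t : v n t <= (1 + d * k ^+ n) * u n t.
  elim: n t => [|n IH] t.
    by rewrite expr0 mulr1 (le_trans (vb t))// ler_pM2r// lerDr.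
  rewrite exprSr mulrA; apply: homogeneous_contraction => // [|s].
    by rewrite mulr_ge0 ?exprn_ge0 ?(ltW d0)//; case/andP: k1.
  (* [F (u n)] stays below [v0], so the factor [k] found for [v0] serves at every step. *)
  rewrite (le_trans _ (kb s))// ler_wpM2l//.
    by case/andP: k1 => _; rewrite subr_ge0; exact: ltW.
  exact: le_trans (uv n.+1 s) (vv0 n.+1 s).
have {}vu n t : v n t <= u n t + d * `|v0| * k ^+ n.
  rewrite (le_trans (vu n t))// mulrDl mul1r lerD2l mulrAC.
  have k0 : 0 <= k by case/andP: k1.
  rewrite ler_wpM2r ?exprn_ge0// ler_wpM2l ?(ltW d0)//.
  rewrite (le_trans (uv n t))// (le_trans (vv0 n t))//.
  exact: contfun_le_norm.
have [x xP] := squeezed_contfun k1 uS vS uv vu.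
have x_gt0 t : 0 < x t by case/andP: (xP 0%N t) => + _; exact: lt_le_trans.
have FxP n t : u n.+1 t <= F x t <= v n.+1 t.
  by apply/andP; split; apply: F_mono => // s; case/andP: (xP n s).
(* Both [x] and [F x] lie between [u n.+1] and [v n.+1], whose gap tends to 0. *)
exists x => //; apply: contfun_eqP => t; apply/eqP.
rewrite eq_le; apply/andP; split; apply: (ler_addgeometric (c := d * `|v0| * k) k1) => n;
  rewrite -[_ * k * _]mulrA -exprS; have := vu n.+1 t; have := xP n.+1 t; have := FxP n t; lra.
Qed.

End homogeneous_plus_constant.

(** * The map [x -> (A x^s)^(1/s)] and the two equations *)

Section power_conjugate.
Context (R : realType) (T : topologicalType) (cT : compact [set: T]).
Local Notation C := (contfun R cT).
Context (A : {linear C -> C}) (b : C) (s : R).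
Hypotheses (T0 : [set: T] !=set0) (A_neq0 : exists x, A x != 0)
  (A_pos : positive_op A) (irrA : irreducible A) (A_cpt : eventually_compact A)
  (b_gt0 : forall t, 0 < b t) (s_neq0 : s != 0).
Implicit Types (f g x y z : C) (t : T).

Let pow0 x (a : R) : (forall t, 0 < x t) -> forall t, contfun_pow x a t = x t `^ a.
Proof. by move=> /ll0P x0 t; rewrite contfun_powE. Qed.

Let pow_gt0 x (a : R) : (forall t, 0 < x t) -> forall t, 0 < contfun_pow x a t.
Proof. by move=> x0 t; rewrite pow0// powR_gt0. Qed.

Let A_gt0 x : (forall t, 0 < x t) -> forall t, 0 < A x t.
Proof.
move=> /contfun_gt0_lb[a a0 ax] t.
have [c c0 cA] := op1_lb A_pos irrA A_neq0.
exact: lt_le_trans (mulr_gt0 a0 c0) (cA x a (ltW a0) ax t).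
Qed.

Definition power_conjugate x := contfun_pow (A (contfun_pow x s)) (1 / s).
Local Notation G := power_conjugate.

Lemma power_conjugateE x : (forall t, 0 < x t) ->
  forall t, G x t = A (contfun_pow x s) t `^ (1 / s).
Proof. by move=> x0 t; rewrite /G pow0//; exact/A_gt0/pow_gt0. Qed.

Lemma power_conjugate_gt0 x : (forall t, 0 < x t) -> forall t, 0 < G x t.
Proof. by move=> x0; exact/pow_gt0/A_gt0/pow_gt0. Qed.

(** For [s < 0] both powers reverse the order, and the two reversals cancel. *)
Lemma power_conjugate_mono f g : (forall t, 0 < f t) ->
  (forall t, f t <= g t) -> forall t, G f t <= G g t.
Proof.
move=> f0 fg t; have g0 u : 0 < g u by exact: lt_le_trans (fg u).
have Af0 u : 0 < A (contfun_pow f s) u by exact/A_gt0/pow_gt0.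
have Ag0 u : 0 < A (contfun_pow g s) u by exact/A_gt0/pow_gt0.
rewrite [leLHS](power_conjugateE f0) [leRHS](power_conjugateE g0).
move: s_neq0; rewrite neq_lt => /orP[s0|s0].
  apply: lt0_ger_powR => //; first by rewrite div1r invr_lt0.
  apply: positive_op_mono => // u; rewrite [leLHS](pow0 _ g0) [leRHS](pow0 _ f0).
  exact: lt0_ger_powR.
rewrite ge0_ler_powR ?nnegrE ?(ltW (Af0 _)) ?(ltW (Ag0 _)) ?div1r ?invr_ge0 ?(ltW s0)//.
apply: positive_op_mono => // u; rewrite [leLHS](pow0 _ f0) [leRHS](pow0 _ g0).
by rewrite ge0_ler_powR ?nnegrE ?(ltW (f0 _)) ?(ltW (g0 _)) ?(ltW s0).
Qed.

Lemma power_conjugate_hom (a : R) f : 0 < a -> (forall t, 0 < f t) ->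
  G (a *: f) = a *: G f.
Proof.
move=> a0 f0; have af0 t : 0 < (a *: f) t by rewrite contfunZE mulr_gt0.
apply: contfun_eqP => t; rewrite [LHS](power_conjugateE af0) contfunZE (power_conjugateE f0).
have -> : contfun_pow (a *: f) s = a `^ s *: contfun_pow f s.
  by apply: contfun_eqP => u; rewrite [LHS](pow0 _ af0) !contfunZE (pow0 _ f0) powRM ?ltW.
rewrite linearZZ contfunZE powRM ?powR_ge0 ?powRVK//.
by rewrite ltW//; exact/A_gt0/pow_gt0.
Qed.

Lemma power_conjugate_contractionP :
  (exists (w : C) (a : R), [/\ forall t, 0 < w t, 0 < a < 1 & forall t, G w t <= a * w t])
  <-> spectral_radius A `^ s < 1.
Proof.
have r0 := spectral_radius_gt0 A_pos T0 irrA A_neq0.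
have s1 : 1 / s != 0 by rewrite div1r invr_eq0.
move: s_neq0; rewrite neq_lt => /orP[s0|s0].
- have s10 : 1 / s < 0 by rewrite div1r invr_lt0.
  rewrite lt0_powR_lt1// -(spectral_radius_gt1P A_pos T0 irrA A_neq0 A_cpt).
  split=> [[w [a [w0 /andP[a0 a1] Gw]]]|[z [a [z0 a1 Az]]]].
    exists (contfun_pow w s), (a `^ s); split=> [||t]; first exact: pow_gt0.
      (* Since [a = (a^s)^(1/s)] with [1/s < 0], [a < 1] means [1 < a^s]. *)
      have := lt0_powR_lt1 s10 (powR_gt0 s a0).
      by rewrite powRVK// a1.
    rewrite (pow0 _ w0) -powRM ?(ltW a0) ?(ltW (w0 _))//.
    have := Gw t; rewrite (power_conjugateE w0 t) => Gwt.
    have Aw : 0 < A (contfun_pow w s) t by exact/A_gt0/pow_gt0.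
    by rewrite -[leRHS](powRKV Aw s_neq0) lt0_ger_powR// powR_gt0.
  have a0 := lt_trans ltr01 a1.
  exists (contfun_pow z (1 / s)), (a `^ (1 / s)); split=> [||t]; first exact: pow_gt0.
    by rewrite powR_gt0// lt0_powR_lt1.
  have z10 := pow_gt0 (1 / s) z0.
  have zK : contfun_pow (contfun_pow z (1 / s)) s = z.
    apply: contfun_eqP => u; by rewrite (pow0 _ z10) (pow0 _ z0) powRKV.
  rewrite (power_conjugateE z10 t) zK.
  rewrite (pow0 _ z0) -powRM ?(ltW a0) ?(ltW (z0 _))//.
  by rewrite lt0_ger_powR// mulr_gt0.
- have s10 : 0 < 1 / s by rewrite div1r invr_gt0.
  rewrite gt0_powR_lt1// -(spectral_radius_lt1P A_pos T0 irrA A_neq0).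
  split=> [[w [a [w0 /andP[a0 a1] Gw]]]|[z [a [z0 /andP[a0 a1] Az]]]].
    exists (contfun_pow w s), (a `^ s); split=> [||t]; first exact: pow_gt0.
      by rewrite powR_gt0// gt0_powR_lt1.
    rewrite (pow0 _ w0) -powRM ?(ltW a0) ?(ltW (w0 _))//.
    have := Gw t; rewrite (power_conjugateE w0 t) => Gwt.
    have Aw : 0 < A (contfun_pow w s) t by exact/A_gt0/pow_gt0.
    rewrite -[leLHS](powRKV Aw s_neq0) ge0_ler_powR ?nnegrE ?powR_ge0 ?(ltW s0)//.
    by rewrite mulr_ge0 ?(ltW a0) ?(ltW (w0 _)).
  exists (contfun_pow z (1 / s)), (a `^ (1 / s)); split=> [||t]; first exact: pow_gt0.
    by rewrite powR_gt0// gt0_powR_lt1.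
  have z10 := pow_gt0 (1 / s) z0.
  have zK : contfun_pow (contfun_pow z (1 / s)) s = z.
    apply: contfun_eqP => u; by rewrite (pow0 _ z10) (pow0 _ z0) powRKV.
  rewrite (power_conjugateE z10 t) zK.
  rewrite (pow0 _ z0) -powRM ?(ltW a0) ?(ltW (z0 _))//.
  by rewrite ge0_ler_powR ?nnegrE ?mulr_ge0 ?(ltW a0) ?(ltW (z0 _)) ?invr_ge0
    ?(ltW s0) ?(ltW (A_gt0 z0 t)).
Qed.

(* The solutions correspond by [y = x^s] and [x = (A y)^(1/s) + b]. *)
Lemma power_conjugate_fixpoint_transfer :
  (exists! x : C, ll 0 x /\ x = G x + b) <->
  (exists! y : C,
    ll 0 y /\ y = contfun_pow (contfun_pow (A y) (1 / s) + b) s).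
Proof.
pose back y := contfun_pow (A y) (1 / s) + b.
have back_gt0 y : (forall t, 0 < y t) -> forall t, 0 < back y t.
  by move=> y0 t; rewrite contfunDE addr_gt0// pow_gt0//; exact: A_gt0.
have powK x : (forall t, 0 < x t) -> contfun_pow (contfun_pow x s) (1 / s) = x.
  move=> x0; apply: contfun_eqP => t; rewrite pow0; last exact: pow_gt0.
  by rewrite pow0// powRVK.
split=> [[x [[/ll0P x0 xG] xU]]|[y [[/ll0P y0 yG] yU]]].
- exists (contfun_pow x s); split.
    split; first by apply/ll0P; exact: pow_gt0.
    exact: (congr1 (fun f => contfun_pow f s) xG).
  move=> y [/ll0P y0 yG]; rewrite [RHS]yG; congr contfun_pow; apply: xU.
  by split; [apply/ll0P; exact: back_gt0 | rewrite /G -yG].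
- exists (back y); split.
    by split; [apply/ll0P; exact: back_gt0 | rewrite /G -yG].
  move=> x [/ll0P x0 xG]; have yE : y = contfun_pow x s.
    apply: yU; split; first by apply/ll0P; exact: pow_gt0.
    exact: (congr1 (fun f => contfun_pow f s) xG).
  by rewrite /back yE -xG.
Qed.

End power_conjugate.

Theorem corollary3p2 (R : realType) (T : topologicalType)
    (cT : compact [set: T]) (hT : hausdorff_space T) (T0 : [set: T] !=set0)
    (A : {linear contfun R cT -> contfun R cT}) (b : contfun R cT) (s : R) :
  (exists x, A x != 0) ->
  positive_op A -> irreducible A -> eventually_compact A ->
  ll 0 b -> s != 0 ->
  ((exists! x : contfun R cT,
      ll 0 x /\ x = contfun_pow (A (contfun_pow x s)) (1 / s) + b)
    <-> spectral_radius A `^ s < 1) /\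
  ((exists! y : contfun R cT,
      ll 0 y /\ y = contfun_pow (contfun_pow (A y) (1 / s) + b) s)
    <-> spectral_radius A `^ s < 1).
Proof.
move=> A_neq0 A_pos irrA A_cpt /ll0P b0 s0.
have xP : (exists! x : contfun R cT,
      ll 0 x /\ x = power_conjugate A s x + b) <-> spectral_radius A `^ s < 1.
  rewrite -(power_conjugate_contractionP T0 A_neq0 A_pos irrA A_cpt s0).
  apply: (homogeneous_fixpointP b0 _ _ _ T0).
  - exact: power_conjugate_gt0.
  - exact: power_conjugate_mono.
  - exact: power_conjugate_hom.
split; first exact: xP.
by rewrite -(power_conjugate_fixpoint_transfer A_neq0 A_pos irrA b0 s0).
Qed.
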